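(* Let $\mathbf{A}$ be a real $m\times n$ matrix with columns $A_1,\ldots,A_n$ and $k\equiv\mathrm{rank}(\mathbf{A})$, and let $\mathbf{A}=\mathbf{U}\mathbf{\Sigma}\mathbf{V}^T$ be a thin SVD. Let $c\geq k$, let $t_1,\ldots,t_c\in\{1,\ldots,n\}$ be not necessarily distinct indices, and let $w_1,\ldots,w_c\geq 0$. Then $$\sum_{j=1}^c w_j\,A_{t_j}A_{t_j}^T=\mathbf{A}\mathbf{A}^T$$ if and only if the $k\times c$ matrix $$\mathbf{V}^T\begin{pmatrix}\sqrt{w_1}\,e_{t_1} & \cdots & \sqrt{w_c}\,e_{t_c}\end{pmatrix}$$ has orthonormal rows.
   Context: The thin SVD of a real $m\times n$ matrix $\mathbf{A}$ of rank $k$ is $\mathbf{A}=\mathbf{U}\mathbf{\Sigma}\mathbf{V}^T$, where $\mathbf{U}$ ($m\times k$) and $\mathbf{V}$ ($n\times k$) have orthonormal columns, $\mathbf{U}^T\mathbf{U}=\mathbf{I}_k=\mathbf{V}^T\mathbf{V}$, and $\mathbf{\Sigma}$ is the $k\times k$ diagonal matrix of the non-zero singular values $\sigma_1\geq\cdots\geq\sigma_k>0$. The vectors $e_1,\ldots,e_n$ are the columns of the identity matrix $\mathbf{I}_n$. *)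

(* Defs.v *)
(* The real numbers are generalized to an arbitrary real closed field. *)
From mathcomp Require Import all_boot all_order all_algebra.

Set Implicit Arguments.
Unset Strict Implicit.
Unset Printing Implicit Defensive.

Import Order.TTheory GRing.Theory Num.Theory.
Local Open Scope ring_scope.

Definition orthonormal_cols (R : rcfType) (m n : nat) (M : 'M[R]_(m, n)) : Prop :=
  M^T *m M = 1%:M.

Definition orthonormal_rows (R : rcfType) (m n : nat) (M : 'M[R]_(m, n)) : Prop :=
  M *m M^T = 1%:M.

(* The diagonal of S lists the non-zero singular values of A in nonincreasing
   order: this is the content of the factorization together with the
   orthonormality, positivity and monotonicity conditions. *)
Definition thin_svd (R : rcfType) (m n k : nat) (A : 'M[R]_(m, n))
    (U : 'M[R]_(m, k)) (S : 'M[R]_k) (V : 'M[R]_(n, k)) : Prop :=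
  [/\ k = \rank A,
      A = U *m S *m V^T,
      orthonormal_cols U /\ orthonormal_cols V,
      is_diag_mx S &
      (forall i : 'I_k, 0 < S i i) /\
      (forall i j : 'I_k, (i <= j)%N -> S j j <= S i i)].

(* Column j is sqrt(w_j) e_(t_j), where e_i is the i-th column of I_n. *)
Definition sampling_mx (R : rcfType) (n c : nat)
    (t : 'I_c -> 'I_n) (w : 'I_c -> R) : 'M[R]_(n, c) :=
  \matrix_(i < n, j < c) (Num.sqrt (w j) *: col (t j) (1%:M : 'M[R]_n)) i 0.

(* Main.v *)
Require Import Defs.
From mathcomp Require Import all_boot all_order all_algebra.

Set Implicit Arguments.
Unset Strict Implicit.
Unset Printing Implicit Defensive.

Import Order.TTheory GRing.Theory Num.Theory.
Local Open Scope ring_scope.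

(** Write [W] for the sampling matrix and [M := V^T *m W].  Column [j] of
    [A *m W] is [sqrt (w j)] times column [t j] of [A], so the weighted sum of
    outer products is the Gram matrix [(A *m W) *m (A *m W)^T]
    ([sum_outer_sampling]).  Put [B := U *m S].  Since [A = B *m V^T], this Gram
    matrix is [B *m (M *m M^T) *m B^T], while [A *m A^T = B *m 1 *m B^T] because
    [V^T *m V = 1].  The singular values being positive, [S] is invertible
    ([diag_mx_unit]) and [B] has the left inverse [S^-1 *m U^T]; hence congruence
    by [B] is injective ([congr_mx_inj]) and the two sides agree
    exactly when [M *m M^T = 1]. *)

Lemma col_mul_sampling (R : rcfType) (m n c : nat) (A : 'M[R]_(m, n))
    (t : 'I_c -> 'I_n) (w : 'I_c -> R) (j : 'I_c) :
  col j (A *m sampling_mx t w) = Num.sqrt (w j) *: col (t j) A.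
Proof.
have -> : col j (A *m sampling_mx t w) =
          A *m (Num.sqrt (w j) *: col (t j) 1%:M).
  rewrite colE -mulmxA -colE; congr (_ *m _).
  by apply/matrixP=> i l; rewrite !ord1 !mxE.
by rewrite -scalemxAr [col _ 1%:M]colE mul1mx -colE.
Qed.

Lemma mulmx_sum_col_row (R : pzSemiRingType) (m n p : nat) (X : 'M[R]_(m, n))
    (Y : 'M[R]_(n, p)) :
  X *m Y = \sum_(j < n) col j X *m row j Y.
Proof.
apply/matrixP=> i l; rewrite mxE summxE; apply: eq_bigr => j _.
by rewrite !mxE big_ord1 !mxE.
Qed.

(** In the column-by-row expansion of a Gram matrix each term is a column times
    its own transpose, so the two factors [sqrt (w j)] multiply to [w j]. *)
Lemma sum_outer_sampling (R : rcfType) (m n c : nat) (A : 'M[R]_(m, n))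
    (t : 'I_c -> 'I_n) (w : 'I_c -> R) (hw : forall j, 0 <= w j) :
  \sum_(j < c) w j *: (col (t j) A *m (col (t j) A)^T)
  = (A *m sampling_mx t w) *m (A *m sampling_mx t w)^T.
Proof.
rewrite mulmx_sum_col_row.
apply: eq_bigr => j _; rewrite -tr_col col_mul_sampling linearZ /=.
by rewrite -scalemxAl -scalemxAr scalerA -expr2 sqr_sqrtr.
Qed.

Lemma diag_mx_unit (F : fieldType) (k : nat) (S : 'M[F]_k) :
  is_diag_mx S -> (forall i, S i i != 0) -> S \in unitmx.
Proof.
move=> dS nz; rewrite unitmxE det_trig ?is_diag_mx_is_trig // unitfE.
by apply/prodf_neq0 => i _.
Qed.

Lemma congr_mx_inj (R : comNzRingType) (m k : nat) (B : 'M[R]_(m, k))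
    (L : 'M[R]_(k, m)) :
  L *m B = 1%:M -> injective (fun X : 'M[R]_k => B *m X *m B^T).
Proof.
move=> LB; apply: (can_inj (g := fun Y => L *m Y *m L^T)) => X.
by rewrite !mulmxA LB mul1mx -mulmxA -trmx_mul LB trmx1 mulmx1.
Qed.

Theorem theorem2p2 (R : rcfType) (m n k c : nat) (A : 'M[R]_(m, n))
    (U : 'M[R]_(m, k)) (S : 'M[R]_k) (V : 'M[R]_(n, k))
    (hsvd : thin_svd A U S V) (hc : (k <= c)%N)
    (t : 'I_c -> 'I_n) (w : 'I_c -> R) (hw : forall j : 'I_c, 0 <= w j) :
  \sum_(j < c) w j *: (col (t j) A *m (col (t j) A)^T) = A *m A^T
  <-> orthonormal_rows (V^T *m sampling_mx t w).
Proof.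
case: hsvd => _ defA [UTU VTV] dS [Spos _].
have uS : S \in unitmx by apply: diag_mx_unit => // i; rewrite gt_eqF.
rewrite sum_outer_sampling // /orthonormal_rows.
set W := sampling_mx t w; set B := U *m S in defA.
have BK : (invmx S *m U^T) *m B = 1%:M.
  by rewrite -mulmxA (mulmxA U^T) UTU mul1mx mulVmx.
have -> : A *m W *m (A *m W)^T = B *m (V^T *m W *m (V^T *m W)^T) *m B^T.
  by rewrite defA !trmx_mul !trmxK !mulmxA.
have -> : A *m A^T = B *m 1%:M *m B^T.
  by rewrite defA trmx_mul trmxK mulmxA -(mulmxA B) VTV.
by split=> [/(congr_mx_inj BK) | ->].
Qed.
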